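(* Let $E\subseteq[0,1]$ be a compact set with $\dim_A E>0$. Then for every $D\in(\dim_A E,\infty]$ there is a Borel probability measure $\mu$ with support equal to $E$ and $\dim_A\mu=D$.
   Context: For a compact set $E$ in a metric space and $F\subseteq E$, $N_r(F)$ denotes the least number of sets of diameter at most $r$ required to cover $F$; $B(x,R)$ is the open ball with centre $x$ and radius $R$. The upper Assouad dimension of $E$ is $$\dim_A E=\inf\Big\{\alpha:(\exists C_1,C_2>0)(\forall\,0<r<R<C_1)\ \sup_{x\in E}N_r(B(x,R)\cap E)\le C_2\Big(\frac Rr\Big)^{\alpha}\Big\}.$$ The upper Assouad dimension (also called upper regularity dimension) of a finite, positive Borel measure $\mu$ with support $\operatorname{supp}\mu$ is $$\dim_A\mu=\inf\Big\{\alpha:(\exists C_1,C_2>0)(\forall\,0<r\le R\le C_1)\ \sup_{x\in\operatorname{supp}\mu}\frac{\mu(B(x,R))}{\mu(B(x,r))}\le C_2\Big(\frac Rr\Big)^{\alpha}\Big\},$$ with the convention $\inf\emptyset=\infty$. *)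

(* Defs.v *)
From HB Require Import structures.
From mathcomp Require Import all_boot all_order all_algebra.
From mathcomp Require Import all_classical all_reals all_analysis.

Set Implicit Arguments.
Unset Strict Implicit.
Unset Printing Implicit Defensive.

Import Order.TTheory GRing.Theory Num.Theory.
Import numFieldTopology.Exports numFieldNormedType.Exports.

Local Open Scope classical_set_scope.
Local Open Scope ring_scope.

Section AssouadDimension.
Context {R : realType} {T : metricType R}.
Local Open Scope ereal_scope.

(** The point [0] is added because [ereal_sup set0 = -oo], whereas the empty
    set has diameter [0]. *)
Definition diameter (U : set T) : \bar R :=
  ereal_sup (0 |` [set (mdist p.1 p.2)%:E | p in U `*` U]).

(** The infimum is a minimum as soon as [F] has a finite cover by sets of
    diameter at most [r], and is [+oo] otherwise. *)
Definition covering_number (r : R) (F : set T) : \bar R :=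
  ereal_inf [set n%:R%:E | n in [set n : nat |
    exists U : 'I_n -> set T,
      (forall i, diameter (U i) <= r%:E) /\ F `<=` \bigcup_i U i]].

(** The exponent [a] ranges over all reals, so the value is [-oo] on the empty
    set; [ereal_inf set0 = +oo] is the usual convention. *)
Definition assouad_dim_set (E : set T) : \bar R :=
  ereal_inf [set a%:E | a in [set a : R |
    exists C1 C2 : R, [/\ (0 < C1)%R, (0 < C2)%R &
      forall r s : R, (0 < r)%R -> (r < s)%R -> (s < C1)%R ->
        ereal_sup [set covering_number r (ball x s `&` E) | x in E]
          <= (C2 * (s / r) `^ a)%:E]]].

Definition msupport (mu : set T -> \bar R) : set T :=
  [set x | forall U, open U -> U x -> 0 < mu U].

(** Meant for finite Borel measures. The quotient is then an ordinary quotient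
    of positive reals, since balls centred in the support have positive mass. *)
Definition assouad_dim_measure (mu : set T -> \bar R) : \bar R :=
  ereal_inf [set a%:E | a in [set a : R |
    exists C1 C2 : R, [/\ (0 < C1)%R, (0 < C2)%R &
      forall r s : R, (0 < r)%R -> (r <= s)%R -> (s <= C1)%R ->
        ereal_sup [set mu (ball x s) / mu (ball x r) | x in msupport mu]
          <= (C2 * (s / r) `^ a)%:E]]].

End AssouadDimension.

(* Main.v *)
From HB Require Import structures.
Require Import Defs.
From mathcomp Require Import all_boot all_order all_algebra.
From mathcomp Require Import all_classical all_reals all_analysis.
From mathcomp Require Import ring lra zify.
Import Order.TTheory GRing.Theory Num.Theory.
Import numFieldTopology.Exports numFieldNormedType.Exports.
Local Open Scope classical_set_scope.
Local Open Scope ring_scope.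

Set Implicit Arguments.
Unset Strict Implicit.
Unset Printing Implicit Defensive.

(** Take nested maximal separated nets of [E] at the scales [r0 / b ^ n] and
    attach each point of a net to a nearby point of the previous one. Spread a
    unit mass down this tree: a point that is new at level [n + 1] receives the
    fraction [b ^ - s n] of the mass of its parent, and the parent, which stays
    in the net, keeps the rest. If [b] is large and [s n > dim_A E], fewer than
    half of the parent's mass is given away. Since neighbouring points with
    different parents are both new, neighbours have comparable masses when [s] is
    constant, so the upper Assouad dimension of the limit measure [mu_s] is the
    exponential rate, in base [b], at which mass can decay along branches.

    For constant [s = t] this rate [A t] is 1-Lipschitz in [t] and at most [t].
    Changing [t] to [c > t] multiplies the decay due to new points by [c / t], and
    for [t] large the remaining decay is negligible, so [dim_A E <= A t] forces
    [A c] to tend to infinity with [c]. As [A D <= D], some [t >= D] has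
    [A t = D]. For [D = +oo] take [s] tending to infinity. *)

Lemma big_fiber (R : nmodType) (A B : eqType) (S : seq A) (Z : seq B)
    (h : A -> B) (P : pred A) (F : A -> R) :
  uniq Z -> {in S, forall y, h y \in Z} ->
  \sum_(y <- S | P y) F y = \sum_(z <- Z) \sum_(y <- S | P y && (h y == z)) F y.
Proof.
move=> uZ hZ.
under [RHS]eq_bigr do rewrite -big_filter_cond big_mkcond/=.
rewrite exchange_big/= big_filter [LHS]big_seq_cond [RHS]big_seq_cond.
apply: eq_bigr => y /andP[yS _].
rewrite (bigD1_seq (h y))/= ?hZ// eqxx big1 ?addr0// => z.
by rewrite eq_sym => /negbTE ->.
Qed.

(** * Limit measure of a consistent sequence of finite weights *)

Section LimitMeasure.
Context (R : realType) (N : nat -> seq R) (m par : nat -> R -> R) (e : nat -> R).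
Hypothesis N_uniq : forall n, uniq (N n).
Hypothesis m_ge0 : forall n x, x \in N n -> 0 <= m n x.
Hypothesis m0_sum : \sum_(x <- N 0%N) m 0%N x = 1.
Hypothesis par_mem : forall n y, y \in N n.+1 -> par n y \in N n.
Hypothesis par_dist : forall n y, y \in N n.+1 -> `|y - par n y| <= e n - e n.+1.
Hypothesis m_par : forall n x, x \in N n ->
  \sum_(y <- N n.+1 | par n y == x) m n.+1 y = m n x.
Hypothesis e_ge0 : forall n, 0 <= e n.

Let F n x := \sum_(y <- N n | y <= x) m n y.

Let sum_le n (P Q : pred R) : (forall y, y \in N n -> P y -> Q y) ->
  \sum_(y <- N n | P y) m n y <= \sum_(y <- N n | Q y) m n y.
Proof.
move=> PQ; rewrite [leLHS]big_mkcond [leRHS]big_mkcond.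
rewrite [leLHS]big_seq [leRHS]big_seq; apply: ler_sum => y yN.
by case: ifPn => [/(PQ _ yN) -> //|_]; case: ifP => // _; exact: m_ge0.
Qed.

Let F_nd n x y : x <= y -> F n x <= F n y.
Proof. by move=> xy; apply: sum_le => z _ /le_trans; exact. Qed.

Let F_diff n u v : u <= v -> F n v - F n u = \sum_(y <- N n | u < y <= v) m n y.
Proof.
move=> uv; apply/eqP; rewrite subr_eq addrC; apply/eqP.
rewrite /F (bigID (fun y => y <= u))/=; congr (_ + _); apply: eq_bigl => y.
  by case: (leP y u) => yu; rewrite ?andbT ?andbF//; exact: le_trans uv.
by rewrite -ltNge andbC.
Qed.

Let F_par n x : F n x = \sum_(y <- N n.+1 | par n y <= x) m n.+1 y.
Proof.
rewrite (@big_fiber _ _ _ _ (N n) (par n))//; last by move=> y; exact: par_mem.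
rewrite /F big_mkcond [LHS]big_seq [RHS]big_seq; apply: eq_bigr => z zN.
case: ifP => zx.
  by rewrite -m_par//; apply: eq_bigl => y; case: eqP => [->|]; rewrite ?zx ?andbF.
by rewrite big_pred0// => y; case: eqP => [->|]; rewrite ?zx ?andbF.
Qed.

(** Passing to the parent moves a point by at most [e n - e n.+1], which is exactly the change of
    the shift. *)
Let F_up n x : F n.+1 (x + e n.+1) <= F n (x + e n).
Proof.
rewrite [leRHS]F_par; apply: sum_le => y yN yx.
by have := par_dist yN; rewrite ler_norml => /andP[]; lra.
Qed.

Let F_dn n x : F n (x - e n) <= F n.+1 (x - e n.+1).
Proof.
rewrite [leLHS]F_par; apply: sum_le => y yN yx.
by have := par_dist yN; rewrite ler_norml => /andP[]; lra.
Qed.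

Let F_le n k x : F n (x - e n) <= F k (x + e k).
Proof.
have up i j : (i <= j)%N -> F j (x + e j) <= F i (x + e i).
  elim: j => [|j IH]; first by rewrite leqn0 => /eqP ->.
  by rewrite leq_eqVlt => /predU1P[->//|/IH]; exact: le_trans (F_up _ _).
have dn i j : (i <= j)%N -> F i (x - e i) <= F j (x - e j).
  elim: j => [|j IH]; first by rewrite leqn0 => /eqP ->.
  by rewrite leq_eqVlt => /predU1P[->//|/IH] /le_trans; exact.
apply: (le_trans (dn _ _ (leq_maxl n k))).
apply: le_trans (up _ _ (leq_maxr n k)).
by apply: F_nd; have := e_ge0 (maxn n k); lra.
Qed.

(* The shift by [e n] makes this sequence of distribution functions
   nonincreasing, and an infimum of nondecreasing right-continuous functions is
   right-continuous. *)
Let G x := inf (range (fun n => F n (x + e n))).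

Let G_inf x : has_inf (range (fun n => F n (x + e n))).
Proof.
split; first by exists (F 0%N (x + e 0%N)), 0%N.
by exists (F 0%N (x - e 0%N)) => _ [n _ <-]; exact: F_le.
Qed.

Let G_le n x : G x <= F n (x + e n).
Proof. by apply: ge_inf; [case: (G_inf x)|exists n]. Qed.

Let G_ge n x : F n (x - e n) <= G x.
Proof. by apply: lb_le_inf; [case: (G_inf x)|move=> _ [k _ <-]; exact: F_le]. Qed.

Let G_nd : nondecreasing G.
Proof.
move=> x y xy; apply: lb_le_inf; first by case: (G_inf y).
move=> _ [n _ <-]; apply: (le_trans (G_le n x)).
by apply: F_nd; rewrite lerD2r.
Qed.

(** [F n] is a step function with finitely many jumps, hence constant just to the right of each
    point. *)
Let F_rc n x : exists2 d, 0 < d & F n (x + d) = F n x.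
Proof.
have [d d0 dP] : exists2 d, 0 < d & {in N n, forall y, y <= x + d -> y <= x}.
  elim: (N n) => [|y s [d d0 IH]]; first by exists 1.
  have [yx|xy] := leP y x.
    by exists d => // z; rewrite inE => /predU1P[->//|]; exact: IH.
  exists (Num.min d ((y - x) / 2)).
    by rewrite lt_min d0 divr_gt0// subr_gt0.
  move=> z; rewrite inE => /predU1P[->|zs].
    have : Num.min d ((y - x) / 2) <= (y - x) / 2 by rewrite ge_min lexx orbT.
    by lra.
  have : Num.min d ((y - x) / 2) <= d by rewrite ge_min lexx.
  by move=> dd zd; apply: IH => //; lra.
exists d => //; apply/eqP; rewrite eq_le; apply/andP; split; first exact: sum_le.
by apply: F_nd; rewrite lerDl ltW.
Qed.

Let G_rc : right_continuous G.
Proof.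
move=> x; apply/cvgrPdist_le => eps eps0.
have [_ [n _ <-] Fn] := inf_adherent eps0 (G_inf x).
have [d d0 dP] := F_rc n (x + e n).
near=> y.
have xy : x <= y by near: y; exact: nbhs_right_ge.
have yd : y <= x + d by near: y; apply: nbhs_right_le; rewrite ltrDl.
have Gxy := G_nd xy; rewrite ler_norml.
have : G y <= F n (x + e n).
  by rewrite (le_trans (G_le n y))// -dP; apply: F_nd; lra.
rewrite -/(G x) in Fn; by move: Gxy Fn; lra.
Unshelve. all: by end_near. Qed.

Let N0_bounded : exists M, {in N 0%N, forall y, `|y| <= M}.
Proof.
exists (\sum_(y <- N 0%N) `|y|) => y yN.
by rewrite (big_rem y)//= lerDl sumr_ge0.
Qed.

Let G_ny : G @ -oo --> (0 : R).
Proof.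
have [M MP] := N0_bounded.
apply/cvgrPdist_le => eps eps0; near=> x.
have Gx : G x <= 0.
  apply: (le_trans (G_le 0%N x)); rewrite /F big_seq_cond big_pred0// => y.
  apply/negbTE/negP => /andP[/MP]; rewrite ler_norml => /andP[+ _].
  suff : x < - M - e 0%N by lra.
  by near: x; apply: nbhs_ninfty_lt; rewrite num_real.
have G0 : 0 <= G x.
  by apply: le_trans (G_ge 0%N x); rewrite /F big_seq_cond sumr_ge0// => y /andP[/m_ge0].
by rewrite sub0r normrN ger0_norm// (le_trans Gx)// ltW.
Unshelve. all: by end_near. Qed.

Let G_y : G @ +oo --> (1 : R).
Proof.
have [M MP] := N0_bounded.
apply/cvgrPdist_le => eps eps0; near=> x.
have F1 z : M < z -> F 0%N z = 1.
  move=> Mz; rewrite /F -m0_sum big_mkcond [LHS]big_seq [RHS]big_seq.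
  apply: eq_bigr => y /MP; rewrite ler_norml => /andP[_ yM].
  by rewrite ifT// (le_trans yM)// ltW.
have Mx : M + e 0%N < x by near: x; apply: nbhs_pinfty_gt; rewrite num_real.
have Gx := G_le 0%N x; have xG := G_ge 0%N x.
have e0 := e_ge0 0%N.
rewrite F1 in Gx; last by lra.
rewrite F1 in xG; last by lra.
by rewrite (_ : G x = 1) ?subrr ?normr0 ?ltW//; apply/eqP; rewrite eq_le Gx.
Unshelve. all: by end_near. Qed.

HB.instance Definition _ := isCumulative.Build R _ R G G_nd G_rc.
HB.instance Definition _ := isCumulativeBounded.Build R 0 1 G G_ny G_y.

(** The Stieltjes measure of [G] gives []u, v]] the mass [G v - G u], and each [G x] lies between
    [F n (x - e n)] and [F n (x + e n)]. *)
Lemma limit_measure : exists mu : probability (measurableTypeR R) R,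
  forall n u v, u <= v ->
    ((\sum_(y <- N n | u + e n < y <= v - e n) m n y)%:E <= mu `]u, v]%classic
     <= (\sum_(y <- N n | u - e n < y <= v + e n) m n y)%:E)%E.
Proof.
exists (lebesgue_stieltjes_measure G) => n u v uv.
have Guv : lebesgue_stieltjes_measure G `]u, v]%classic = (G v - G u)%:E.
  rewrite /lebesgue_stieltjes_measure /measure_extension measurable_mu_extE/=.
    by rewrite wlength_itv_bnd.
  exact: is_ocitv.
rewrite -[mu in (_ <= mu <= _)%E]/(lebesgue_stieltjes_measure G `]u, v]%classic).
rewrite Guv !lee_fin.
have e0 := e_ge0 n; apply/andP; split.
  (* When the endpoints of the shrunken interval cross, its sum is empty and monotonicity of [G]
     suffices. *)
  have [le|lt] := leP (u + e n) (v - e n).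
    by rewrite -F_diff// lerB// ?G_le ?G_ge.
  rewrite big_pred0 ?subr_ge0 ?G_nd// => y.
  by apply/negbTE/negP => /andP[uy /(lt_le_trans uy)]; rewrite ltNge ltW.
by rewrite -F_diff ?lerB ?G_le ?G_ge//; lra.
Qed.

End LimitMeasure.

(** * Separated sets and trees of nested nets *)

Definition separated (R : realType) (r : R) (s : seq R) :=
  {in s &, forall x y, x != y -> r <= `|x - y|}.

(** Separated points have different integer parts of [(x - a) / r], and these take at most [L.+1]
    values. *)
Lemma size_separated (R : realType) (r a : R) (L : nat) (s : seq R) :
  0 < r -> uniq s -> separated r s ->
  {in s, forall x, a <= x <= a + L%:R * r} -> (size s <= L.+1)%N.
Proof.
move=> r0 us sr sa.
pose f x := Num.truncn ((x - a) / r).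
have f_itv x : x \in s -> (f x)%:R * r <= x - a < (f x).+1%:R * r.
  move=> xs; rewrite -ler_pdivlMr// -ltr_pdivrMr//; apply: truncn_itv.
  by have /andP[ax _] := sa _ xs; rewrite divr_ge0 ?subr_ge0 ?(ltW r0).
rewrite -(size_map f) -(size_iota 0 L.+1); apply: uniq_leq_size.
  rewrite map_inj_in_uniq// => x y xs ys fxy; apply/eqP/negP => /negP /(sr _ _ xs ys).
  have := f_itv _ xs; have := f_itv _ ys; rewrite fxy.
  rewrite -natr1 mulrDl mul1r => /andP[? ?] /andP[? ?].
  by apply/negP; rewrite -ltNge ltr_norml; apply/andP; split; lra.
move=> _ /mapP[x xs ->]; rewrite mem_iota add0n ltnS /=.
have /andP[fx _] := f_itv _ xs; have /andP[_ xa] := sa _ xs.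
rewrite -(ler_nat R) -(ler_pM2r r0); apply: (le_trans fx).
by rewrite lerBlDl.
Qed.

(** Points far from the list are added one at a time; by [size_separated] this stops. *)
Lemma maximal_separated (R : realType) (E : set R) (r : R) (s : seq R) :
  E `<=` `[0, 1] -> 0 < r ->
  uniq s -> {in s, forall x, E x} -> separated r s ->
  exists t, [/\ uniq t, {in t, forall x, E x}, separated r t,
    {subset s <= t} & forall x, E x -> exists2 y, y \in t & `|x - y| < r].
Proof.
move=> E01 r0; set L := (Num.truncn r^-1).+1.
have Lr : 1 <= L%:R * r.
  have /truncn_itv/andP[_ /ltW] : 0 <= r^-1 by rewrite invr_ge0 ltW.
  by rewrite -ler_pdivrMr// div1r.
have bound t : uniq t -> {in t, forall x, E x} -> separated r t -> (size t <= L.+1)%N.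
  move=> ut Et st; apply: (@size_separated _ r 0) => // x /Et/E01/=.
  by rewrite in_itv/= add0r => /andP[-> /le_trans]; exact.
have [k] := ubnP (L.+1 - size s)%N; elim: k s => // k IH s ks us Es ss.
have [full|/existsNP[x /not_implyP[Ex xfar]]] :=
    pselect (forall x, E x -> exists2 y, y \in s & `|x - y| < r).
  by exists s; split.
have xs y : y \in s -> r <= `|x - y|.
  by move=> ys; rewrite leNgt; apply/negP => xy; apply: xfar; exists y.
have uxs : uniq (x :: s).
  by rewrite /= us andbT; apply/negP => /xs; rewrite subrr normr0 leNgt r0.
have Exs : {in x :: s, forall y, E y}.
  by move=> y; rewrite inE => /predU1P[->//|/Es].
have sxs : separated r (x :: s).
  move=> y z; rewrite !inE => /predU1P[->|ys] /predU1P[->|zs]; rewrite ?eqxx//.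
  - by move=> _; exact: xs.
  - by move=> _; rewrite distrC; exact: xs.
  - exact: ss.
have [|//|//|//|t [ut Et st xst tE]] := IH (x :: s).
  by have := bound _ uxs Exs sxs; rewrite /= => sL; move: ks; lia.
by exists t; split => // y ys; apply: xst; rewrite inE ys orbT.
Qed.

(** Separation and covering radii coincide because the nets are maximal. By separation at most one
    point of [N n] is closer to [y] than half that radius, so [par_near] is consistent; it forces
    old points to be their own parents. *)
Record net_tree (R : realType) (E : set R) (b r0 : R) (N : nat -> seq R)
    (par : nat -> R -> R) : Prop := NetTree {
  net_base : 64 <= b;
  net_r0 : 0 < r0;
  net_uniq : forall n, uniq (N n);
  net_sub : forall n x, x \in N n -> E x;
  net_sep : forall n, separated (r0 / b ^+ n) (N n);
  net_mono : forall n, {subset N n <= N n.+1};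
  net_cover : forall n x, E x -> exists2 y, y \in N n & `|x - y| < r0 / b ^+ n;
  par_mem : forall n y, y \in N n.+1 -> par n y \in N n;
  par_dist : forall n y, y \in N n.+1 -> `|y - par n y| < r0 / b ^+ n;
  par_near : forall n x y, y \in N n.+1 -> x \in N n ->
    `|y - x| < r0 / b ^+ n / 2 -> par n y = x }.

Lemma net_tree_exists (R : realType) (E : set R) (b r0 : R) :
  E `<=` `[0, 1] -> 64 <= b -> 0 < r0 ->
  exists N par, net_tree E b r0 N par.
Proof.
move=> E01 b64 r00; have b0 : 0 < b by lra.
pose rho n := r0 / b ^+ n.
have rho0 n : 0 < rho n by rewrite divr_gt0// exprn_gt0.
pose good n s := [/\ uniq s, {in s, forall x : R, E x} & separated (rho n) s].
(* The extension is made total on all lists, so that the recursion can be written before its values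
   are known to be [good]. *)
have /choice[ext extP] (p : nat * seq R) : exists t, good p.1 p.2 ->
    [/\ good p.1 t, {subset p.2 <= t}
      & forall x, E x -> exists2 y, y \in t & `|x - y| < rho p.1].
  have [[us Es ss]|] := pselect (good p.1 p.2); last by exists [::].
  have [t [ut Et st sub tE]] := maximal_separated E01 (rho0 p.1) us Es ss.
  by exists t.
pose fix N n := if n is k.+1 then ext (n, N k) else ext (0%N, [::]).
have good_weaken n s : good n s -> good n.+1 s.
  move=> [us Es ss]; split => // x y xs ys xy; apply: le_trans (ss _ _ xs ys xy).
  rewrite /rho ler_pM2l// lef_pV2 ?posrE ?exprn_gt0//.
  by rewrite exprS ler_peMl ?exprn_ge0 ?ltW//; lra.
have NP n : good n (N n) /\
    forall x, E x -> exists2 y, y \in N n & `|x - y| < rho n.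
  elim: n => [|n [gN _]]; first by have [|? ? ?] := extP (0%N, [::]).
  by have [|? ? ?] := extP (n.+1, N n); [exact: good_weaken|].
have mono n : {subset N n <= N n.+1}.
  have [gN _] := NP n.
  by have [|? + ?] := extP (n.+1, N n); first exact: good_weaken.
(* A net point closer than half the radius becomes the parent if there is one; separation makes it
   unique. Otherwise any covering point serves. *)
have /choice[par parP] (p : nat * R) : exists x, E p.2 ->
    [/\ x \in N p.1, `|p.2 - x| < rho p.1
      & forall z, z \in N p.1 -> `|p.2 - z| < rho p.1 / 2 -> x = z].
  case: p => n y /=; have [Ey|] := pselect (E y); last by exists 0.
  have [[_ _ sN] cN] := NP n; have r0n := rho0 n.
  have [[x xN xy]|far] := pselect (exists2 x, x \in N n & `|y - x| < rho n / 2).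
    exists x => _; split => //; first by lra.
    move=> z zN zy; apply/eqP/negP => /negP /(sN _ _ xN zN).
    by apply/negP; rewrite -ltNge; move: xy zy; rewrite !ltr_norml; lra.
  have [x xN xy] := cN y Ey.
  by exists x => _; split => // z zN zy; case: far; exists z.
have NE n x : x \in N n -> E x by have [[_ + _] _] := NP n; exact.
exists N, (fun n y => par (n, y)); split => //.
- by move=> n; have [[]] := NP n.
- by move=> n; have [[]] := NP n.
- by move=> n; have [] := NP n.
- by move=> n y /NE Ey; have [] := parP (n, y) Ey.
- by move=> n y /NE Ey; have [] := parP (n, y) Ey.
- move=> n x y /NE Ey xN xy; have [_ _] := parP (n, y) Ey; exact.
Qed.

(** * Masses on the tree *)

Section Weights.
Context (R : realType) (E : set R) (b r0 : R) (N : nat -> seq R)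
  (par : nat -> R -> R).

Definition new_children n x :=
  count (fun y => (y \notin N n) && (par n y == x)) (N n.+1).

(* The fraction of the mass of [par n y] that is given to [y] in [N n.+1]. *)
Definition step (s : nat -> R) n y :=
  if y \in N n then 1 - (new_children n y)%:R * b `^ (- s n) else b `^ (- s n).

Fixpoint mass (s : nat -> R) n y :=
  if n is k.+1 then step s k y * mass s k (par k y)
  else (size (N 0%N))%:R^-1.

Fixpoint ancestor k l y :=
  if l is l'.+1 then ancestor k l' (par (k + l') y) else y.

(** The share of the mass of the level [k] ancestor of [y] that reaches [y] at level [k + l]. *)
Fixpoint branch (s : nat -> R) k l y :=
  if l is l'.+1 then step s (k + l') y * branch s k l' (par (k + l') y) else 1.

Hypothesis T : net_tree E b r0 N par.
Local Notation rho n := (r0 / b ^+ n).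

Lemma net_base_gt1 : 1 < b.
Proof. by have := net_base T; lra. Qed.

Lemma net_base_gt0 : 0 < b.
Proof. by have := net_base T; lra. Qed.

Lemma net_radius_gt0 n : 0 < rho n.
Proof. by rewrite divr_gt0 ?(net_r0 T)// exprn_gt0// net_base_gt0. Qed.

Lemma net_radiusS n : rho n = b * rho n.+1.
Proof.
by rewrite exprS invfM mulrCA [b * (_ * _)]mulrA divff ?mul1r// gt_eqF// net_base_gt0.
Qed.

Lemma net_radius_le n k : (n <= k)%N -> rho k <= rho n.
Proof.
move=> nk; rewrite ler_pM2l ?(net_r0 T)// lef_pV2 ?posrE ?exprn_gt0 ?net_base_gt0//.
by rewrite ler_weXn2l// ltW// net_base_gt1.
Qed.

Lemma net_radius64 n : 64 * rho n.+1 <= rho n.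
Proof. by rewrite [leRHS]net_radiusS ler_pM2r ?net_radius_gt0// (net_base T). Qed.

Lemma par_id n x : x \in N n -> par n x = x.
Proof.
move=> xN; apply: (par_near T) => //; first exact: (net_mono T).
by rewrite subrr normr0 divr_gt0// net_radius_gt0.
Qed.

Lemma ancestor_mem k l y : y \in N (k + l) -> ancestor k l y \in N k.
Proof.
elim: l y => [|l IH] y /=; first by rewrite addn0.
by rewrite addnS => /(par_mem T); exact: IH.
Qed.

Lemma ancestor_dist k l y : y \in N (k + l) -> `|y - ancestor k l y| < 2 * rho k.
Proof.
move=> yN.
(* The sharper bound telescopes, since [rho n <= 2 * rho n - 2 * rho n.+1]. *)
suff : `|y - ancestor k l y| <= 2 * rho k - 2 * rho (k + l)%N.
  by have := net_radius_gt0 (k + l); lra.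
elim: l y yN => [|l IH] y /=; first by rewrite addn0 !subrr normr0.
rewrite addnS => yN; have := IH _ (par_mem T yN); have := par_dist T yN.
have := net_radius64 (k + l); have := net_radius_gt0 (k + l).+1.
by rewrite !ler_norml !ltr_norml; lra.
Qed.

Lemma mass_branch s k l y :
  mass s (k + l) y = branch s k l y * mass s k (ancestor k l y).
Proof.
elim: l y => [|l IH] y /=; first by rewrite addn0 mul1r.
by rewrite addnS /= IH mulrA.
Qed.

Section Bounded.
Variable s0 : R.
Hypothesis E_neq0 : E !=set0.
Hypothesis children_le : forall n x, x \in N n ->
  (new_children n x).+1%:R <= b `^ s0 / 2.
Variable s : nat -> R.
Hypothesis s_ge : forall n, s0 <= s n.

Lemma net_neq0 n : (0 < size (N n))%N.
Proof. by have [x /(net_cover T n)[y]] := E_neq0; case: (N n). Qed.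

Lemma ratio_gt0 (t : R) : 0 < b `^ t.
Proof. by rewrite powR_gt0// net_base_gt0. Qed.

(** The successor counts the parent too. Hence less than half of its mass is given away and a single
    share is at most one half, so the parent keeps at least as much as a new child gets. *)
Lemma children_ratio n x (t : R) : s0 <= t -> x \in N n ->
  (new_children n x).+1%:R * b `^ (- t) <= 1 / 2.
Proof.
move=> st /children_le; rewrite -(ler_pM2r (ratio_gt0 (- t))) => /le_trans; apply.
rewrite mulrAC ler_pdivrMr// divfK// -powRD; last first.
  by rewrite (gt_eqF net_base_gt0) implybT.
by rewrite -(powRr0 b) ler_powR ?(ltW net_base_gt1)// subr_le0.
Qed.

Lemma ratio_le1 (t : R) : s0 <= t -> b `^ (- t) <= 1 / 2.
Proof.
move=> st; have [x Ex] := E_neq0; have [y yN _] := net_cover T 0 Ex.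
have := children_ratio st yN; have := ratio_gt0 (- t).
rewrite -[(new_children _ _).+1%:R]natr1 mulrDl mul1r.
have : 0 <= (new_children 0 y)%:R * b `^ (- t) by rewrite mulr_ge0// powR_ge0.
by lra.
Qed.

Lemma step_ge n y : b `^ (- s n) <= step s n y.
Proof.
rewrite /step; case: ifP => // yN; have := children_ratio (s_ge n) yN.
by have := ratio_le1 (s_ge n); rewrite -[(new_children _ _).+1%:R]natr1 mulrDl mul1r; lra.
Qed.

Lemma step_gt0 n y : 0 < step s n y.
Proof. exact: lt_le_trans (ratio_gt0 _) (step_ge n y). Qed.

Lemma step_le1 n y : step s n y <= 1.
Proof.
rewrite /step; case: ifP => yN; last by have := ratio_le1 (s_ge n); lra.
by rewrite gerBl mulr_ge0// powR_ge0.
Qed.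

Lemma mass_gt0 n y : 0 < mass s n y.
Proof.
elim: n y => [|n IH] y /=; first by rewrite invr_gt0 ltr0n net_neq0.
by rewrite mulr_gt0// step_gt0.
Qed.

Lemma branch_gt0 k l y : 0 < branch s k l y.
Proof. by elim: l y => //= l IH y; rewrite mulr_gt0// step_gt0. Qed.

Lemma mass_sum0 : \sum_(x <- N 0%N) mass s 0%N x = 1.
Proof.
rewrite big_const_seq count_predT iter_addr_0 -[(size _)%:R^-1 *+ _]mulr_natl mulfV// pnatr_eq0.
by rewrite -lt0n net_neq0.
Qed.

(** The children of [x] are its new children and [x] itself, which keeps the complement of their
    shares. *)
Lemma mass_par n x : x \in N n ->
  \sum_(y <- N n.+1 | par n y == x) mass s n.+1 y = mass s n x.
Proof.
move=> xN.
transitivity ((\sum_(y <- N n.+1 | par n y == x) step s n y) * mass s n x).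
  by rewrite mulr_suml; apply: eq_bigr => y /eqP /= ->.
suff -> : \sum_(y <- N n.+1 | par n y == x) step s n y = 1 by rewrite mul1r.
rewrite big_mkcond (bigD1_seq x)/= ?(net_uniq T) ?(net_mono T)// par_id// eqxx.
rewrite (_ : \sum_(y <- _ | _) _ = (new_children n x)%:R * b `^ (- s n)).
  by rewrite /step xN subrK.
rewrite mulr_natl -iter_addr_0 /new_children -big_const_seq.
rewrite [LHS]big_mkcond [RHS]big_mkcond [LHS]big_seq [RHS]big_seq.
apply: eq_bigr => y yN; rewrite /step; have [yNn|yNn]/= := boolP (y \in N n).
  by rewrite par_id//; case: eqP.
by have [yx|//] := eqVneq y x; rewrite yx xN in yNn.
Qed.

Lemma mass_ancestor k l z : z \in N k ->
  \sum_(y <- N (k + l) | ancestor k l y == z) mass s (k + l) y = mass s k z.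
Proof.
move=> zN; elim: l => [|l IH] /=.
  rewrite addn0 big_mkcond (bigD1_seq z)/= ?(net_uniq T)// eqxx big1 ?addr0// => y.
  by case: eqP.
rewrite addnS (@big_fiber _ _ _ _ (N (k + l)) (par (k + l))) ?(net_uniq T)//; last first.
  by move=> y; exact: (par_mem T).
rewrite -IH [RHS]big_mkcond [LHS]big_seq [RHS]big_seq; apply: eq_bigr => w wN.
case: ifP => wz.
  rewrite -(mass_par wN); apply: eq_bigl => y.
  by case: (par _ _ =P w) => [->|]; rewrite ?wz ?andbF.
by rewrite big_pred0// => y; case: (par _ _ =P w) => [->|]; rewrite ?wz ?andbF.
Qed.

(** The shift [2 * rho n] in [limit_measure] bounds the geometric series of all displacements from
    level [n] on. *)
Lemma tree_measure : exists mu : probability (measurableTypeR R) R,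
  forall n u v, u <= v ->
    ((\sum_(y <- N n | u + 2 * rho n < y <= v - 2 * rho n) mass s n y)%:E
       <= mu `]u, v]%classic
     <= (\sum_(y <- N n | u - 2 * rho n < y <= v + 2 * rho n) mass s n y)%:E)%E.
Proof.
apply: (@limit_measure _ N (mass s) par (fun n => 2 * rho n)).
- exact: (net_uniq T).
- by move=> n x _; exact: ltW (mass_gt0 n x).
- exact: mass_sum0.
- exact: (par_mem T).
- move=> n y yN; have := par_dist T yN; have := net_radius64 n.
  by have := net_radius_gt0 n.+1; lra.
- exact: mass_par.
- by move=> n; have := net_radius_gt0 n; lra.
Qed.

End Bounded.
End Weights.

(** * Decay along branches and the dimensions of the set and of the measure *)

Section TreeMeasure.
Context (R : realType) (E : set R) (b r0 s0 : R) (N : nat -> seq R)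
  (par : nat -> R -> R).
Hypothesis T : net_tree E b r0 N par.
Hypothesis E_neq0 : E !=set0.
Hypothesis children_le : forall n x, x \in N n ->
  (new_children N par n x).+1%:R <= b `^ s0 / 2.
Local Notation rho n := (r0 / b ^+ n).
Local Notation anc := (ancestor par).
Let rho_gt0 := net_radius_gt0 T.

(* Up to a constant, masses decrease at most by the factor [b `^ a] per level. *)
Definition homogeneous (s : nat -> R) (a : R) := exists K C, 0 < C /\
  forall k l y, (K <= k)%N -> y \in N (k + l) ->
    1 <= C * (b `^ a) ^+ l * branch b N par s k l y.

Lemma net_radius_small e : 0 < e -> exists n, rho n < e.
Proof.
move=> e0; exists (Num.truncn (r0 / e)).+1; set n := _.+1.
have b0 := net_base_gt0 T; have n0 : 0 < n%:R :> R by rewrite ltr0n.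
rewrite ltr_pdivrMr ?exprn_gt0// -ltr_pdivrMl// mulrC.
have /truncn_itv/andP[_ /lt_le_trans] : 0 <= r0 / e.
  by rewrite divr_ge0 ?ltW// (net_r0 T).
apply; apply: (@le_trans _ _ (2 ^+ n)); last first.
  by rewrite lerXn2r ?nnegrE//; have := net_base T; lra.
by rewrite -natrX ler_nat ltnW// ltn_expl.
Qed.

(** Level [k] is the last with [t <= rho k], and [k + l] is the first with [rho] below [r / 4]; one
    level is lost at either end, whence [b ^+ 2]. *)
Lemma scales K r t : 0 < r -> r <= t -> t <= rho K ->
  exists k l, [/\ (K <= k)%N, t <= rho k, 4 * rho (k + l)%N <= r
    & b ^+ l <= 4 * b ^+ 2 * (t / r)].
Proof.
move=> r_gt0 rt tK; have t_gt0 := lt_le_trans r_gt0 rt.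
have b0 := net_base_gt0 T.
have [k kt kmin] := ex_minnP (net_radius_small t_gt0).
have k0 : (K < k)%N.
  by rewrite ltnNge; apply/negP => /(net_radius_le T); rewrite leNgt (lt_le_trans kt).
case: k kt kmin k0 => // k kt kmin k0.
have tk : t <= rho k by rewrite leNgt; apply/negP => /kmin; rewrite ltnn.
have r40 : 0 < r / 4 by rewrite divr_gt0.
have [n nr nmin] := ex_minnP (net_radius_small r40).
have kn : (k < n)%N.
  rewrite ltnNge; apply/negP => /(net_radius_le T) nk.
  by have := rho_gt0 k; move: nr nk tk rt; lra.
case: n nr nmin kn => // n nr nmin; rewrite ltnS => kn.
have rn : r <= 4 * rho n.
  have : r / 4 <= rho n by rewrite leNgt; apply/negP => /nmin; rewrite ltnn.
  by lra.
exists k, (n.+1 - k)%N; split => //; first by rewrite subnKC ?(leqW kn)//; lra.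
rewrite expfB; last by rewrite ltnS.
have X0 : 0 < b ^+ k by rewrite exprn_gt0.
have Y0 : 0 < b ^+ n by rewrite exprn_gt0.
rewrite mulrA ler_pdivlMr// in rn.
rewrite ltr_pdivrMr ?exprn_gt0// exprS in kt.
have /(ler_wpM2l (ltW b0)) : b ^+ n <= 4 * (t * (b * b ^+ k)) / r.
  by rewrite ler_pdivlMr// mulrC; lra.
rewrite ler_pdivrMr// exprS => /le_trans; apply.
by rewrite le_eqVlt; apply/orP; left; apply/eqP; ring.
Qed.

Lemma powR_expn a l : (b `^ a) ^+ l = (b ^+ l) `^ a.
Proof.
have b0 := ltW (net_base_gt0 T).
by rewrite -powR_mulrn ?powR_ge0// powRAC powR_mulrn.
Qed.

Lemma powR_expn_le a l X : 0 <= a -> b ^+ l <= X -> (b `^ a) ^+ l <= X `^ a.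
Proof.
move=> a_ge0 lX; have bl : 0 <= b ^+ l by rewrite exprn_ge0// ltW// (net_base_gt0 T).
by rewrite powR_expn ge0_ler_powR ?nnegrE// (le_trans bl).
Qed.

(* Two points of [N k.+1] that are close but have different parents are both new,
   so passing to the parents divides both masses by the same factor. *)
Lemma mass_near t k x y : s0 <= t -> x \in N k -> y \in N k ->
  `|x - y| <= 8 * rho k ->
  b `^ (- t) * mass b N par (fun=> t) k x <= mass b N par (fun=> t) k y.
Proof.
move=> st.
have m0 := mass_gt0 T E_neq0 children_le (s := fun=> t) (fun=> st).
have lam0 : 0 < b `^ (- t) by exact: ratio_gt0 T (- t).
have lam1 : b `^ (- t) <= 1.
  by have := ratio_le1 T E_neq0 children_le st; lra.
elim: k x y => [|k IH] x y xN yN xy /=; first by rewrite ler_piMl// invr_ge0.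
have sx1 := step_le1 T E_neq0 children_le (s := fun=> t) (fun=> st) k x.
have sy := step_ge T E_neq0 children_le (s := fun=> t) (fun=> st) k y.
have rk := rho_gt0 k; have rk1 := rho_gt0 k.+1; have rkk := net_radius64 T k.
have [pxy|pxy] := eqVneq (par k x) (par k y).
  rewrite pxy mulrA ler_pM2r//; apply: le_trans sy.
  by rewrite ler_piMr// ltW.
have new u v : u \in N k.+1 -> v \in N k.+1 -> `|u - v| <= 8 * rho k.+1 ->
    par k u != par k v -> step b N par (fun=> t) k u = b `^ (- t).
  move=> uN vN uv puv; rewrite /step; case: ifPn => // uk.
  move: puv; rewrite (par_id T uk) (par_near T vN uk) ?eqxx//.
  by rewrite distrC; lra.
rewrite (new x y)// (new y x)//; first last.
- by rewrite eq_sym.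
- by rewrite distrC.
(* The constant 8 reproduces itself: the parents are within
   [8 * rho k.+1 + 2 * rho k <= 8 * rho k]. *)
rewrite mulrCA ler_pM2l//; apply: IH; [exact: (par_mem T)|exact: (par_mem T)|].
have := par_dist T xN; have := par_dist T yN; move: xy.
by rewrite !ler_norml !ltr_norml; lra.
Qed.

(** A mass count: each point of level [k + l] near [x] receives a definite fraction of the mass of
    its level [k] ancestor, at most nine ancestors occur, and the fractions below one ancestor add
    up to at most 1. Balls around these points form the cover. *)
Lemma assouad_dim_set_le s a : (forall n, s0 <= s n) -> 0 <= a ->
  homogeneous s a -> (assouad_dim_set (E : set R^o) <= a%:E)%E.
Proof.
move=> s_ge a_ge0 [K [C [C_gt0 hom]]].
have m0 := mass_gt0 T E_neq0 children_le s_ge.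
have b0 := net_base_gt0 T.
apply: ereal_inf_lbound; exists a => //.
exists (rho K), (9 * C * (4 * b ^+ 2) `^ a); split => //.
  by rewrite !mulr_gt0// powR_gt0// mulr_gt0// exprn_gt0.
move=> r t r_gt0 rt tK.
have [k [l [Kk tk rkl bl]]] := scales r_gt0 (ltW rt) (ltW tK).
apply: ge_ereal_sup => _ [x Ex <-].
set n := (k + l)%N in rkl; have rn := rho_gt0 n; have rk := rho_gt0 k.
have nk : rho n <= rho k by rewrite (net_radius_le T)// leq_addr.
pose S := [seq y <- N n | `|x - y| < t + rho n].
(* The radius adds [t + rho n <= 2 * rho k] to the distance [2 * rho k] from a point to its
   ancestor. *)
pose Z := [seq z <- N k | `|x - z| <= 4 * rho k].
have Zsize : (size Z <= 9)%N.
  apply: (@size_separated _ (rho k) (x - 4 * rho k)) => //.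
  - by rewrite filter_uniq// (net_uniq T).
  - move=> u v; rewrite !mem_filter => /andP[_ uN] /andP[_ vN].
    exact: (net_sep T).
  - by move=> u; rewrite mem_filter => /andP[+ _]; rewrite ler_norml; lra.
have SZ y : y \in S -> anc k l y \in Z.
  rewrite !mem_filter => /andP[xy yN]; rewrite (ancestor_mem T)// andbT.
  have := ancestor_dist T yN; move: xy.
  by rewrite !ler_norml !ltr_norml; lra.
have Ssize : (size S)%:R <= C * (b `^ a) ^+ l * 9.
  have Cb : 0 <= C * (b `^ a) ^+ l by rewrite mulr_ge0 ?exprn_ge0 ?powR_ge0 ?ltW.
  have sum1 (s' : seq R) : \sum_(y <- s') (1 : R) = (size s')%:R.
    by rewrite big_const_seq count_predT iter_addr_0.
  rewrite -sum1.
  apply: (@le_trans _ _ (\sum_(y <- S)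
      C * (b `^ a) ^+ l * (mass b N par s n y / mass b N par s k (anc k l y)))).
    rewrite big_seq [leRHS]big_seq; apply: ler_sum => y.
    rewrite mem_filter => /andP[_ yN].
    rewrite (mass_branch _ _ _ s k l y) mulfK ?gt_eqF//.
    exact: hom.
  rewrite -mulr_sumr ler_wpM2l//.
  rewrite (@big_fiber _ _ _ _ Z (anc k l))//; last by rewrite filter_uniq// (net_uniq T).
  apply: (@le_trans _ _ (\sum_(z <- Z) 1)).
    rewrite big_seq [leRHS]big_seq; apply: ler_sum => z.
    rewrite mem_filter => /andP[_ zN].
    rewrite (eq_bigr (fun y => mass b N par s n y / mass b N par s k z)); last first.
      by move=> y /eqP ->.
    rewrite -mulr_suml ler_pdivrMr// mul1r.
    rewrite -(mass_ancestor T s l zN) big_filter_cond.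
    rewrite big_mkcond [leRHS]big_mkcond; apply: ler_sum => y _.
    by case: (_ < _) => //=; case: ifP => // _; exact: ltW.
  by rewrite sum1 ler_nat.
apply: (@le_trans _ _ (size S)%:R%:E).
  apply: ereal_inf_lbound; exists (size S) => //=.
  exists (fun i : 'I_(size S) => ball (nth 0 S i : R^o) (rho n)); split.
    move=> i; apply: ge_ereal_sup => _ [->|[[u v] [/= iu iv] <-]].
      by rewrite lee_fin ltW.
    rewrite lee_fin.
    have -> : mdist (u : R^o) v = `|v - u| by [].
    by move: iu iv; rewrite /ball/= !ltr_norml ler_norml; lra.
  move=> y [xy Ey]; have [z zN yz] := net_cover T n Ey.
  have zS : z \in S.
    rewrite mem_filter zN andbT; move: xy yz.
    by rewrite /ball/= !ltr_norml; lra.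
  exists (Ordinal (etrans (index_mem _ _) zS)) => //.
  by rewrite /= nth_index// /ball/= distrC.
rewrite lee_fin; apply: (le_trans Ssize).
rewrite mulrC -3!mulrA ler_pM2l// ler_pM2l//.
rewrite -powRM ?divr_ge0 ?mulr_ge0 ?exprn_ge0 ?(ltW b0) ?(ltW r_gt0)//; last first.
  by rewrite (le_trans (ltW r_gt0))// ltW.
exact: powR_expn_le.
Qed.

Section Measure.
Variables (s : nat -> R) (mu : probability (measurableTypeR R) R).
Hypothesis s_ge : forall n, s0 <= s n.
Local Notation mass := (mass b N par s).
Local Notation branch := (branch b N par s).
Hypothesis muP : forall n u v, u <= v ->
    ((\sum_(y <- N n | (u + 2 * rho n < y <= v - 2 * rho n)%R) mass n y)%:E
       <= mu `]u, v]%classic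
     <= (\sum_(y <- N n | (u - 2 * rho n < y <= v + 2 * rho n)%R) mass n y)%:E)%E.
Let mass_gt0 := mass_gt0 T E_neq0 children_le s_ge.

Lemma mu_ball_ge n x y r : y \in N n -> `|x - y| + 2 * rho n < r ->
  ((mass n y)%:E <= mu (ball (x : R^o) r))%E.
Proof.
(* [d] lies strictly between the required radius and [r]: the half-open interval fits into the open
   ball and still captures [y]. *)
move=> yN xyr; pose d := (`|x - y| + 2 * rho n + r) / 2.
have r0n := rho_gt0 n; have nxy := normr_ge0 (x - y).
have uv : x - d <= x + d by rewrite /d; lra.
have /andP[+ _] := muP n uv; move=> /(fun h => le_trans _ h) h.
apply: (@le_trans _ _ (mu `]x - d, x + d]%classic)); last first.
  apply: le_measure; rewrite ?inE//.
    exact: measurable_realfun.measurable_ball.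
  move=> z /=; rewrite in_itv/= => /andP[z1 z2]; rewrite /ball/= ltr_norml.
  by rewrite /d in z1 z2; lra.
apply: h; rewrite lee_fin (big_rem y)//= ifT.
  by rewrite lerDl sumr_ge0// => z _; exact: ltW.
by rewrite /d; have := ler_norm (x - y); have := ler_norm (y - x); rewrite distrC; lra.
Qed.

Lemma mu_ball_le n x r : 0 <= r ->
  (mu (ball (x : R^o) r) <=
    (\sum_(y <- N n | `|x - y| <= r + 2 * rho n) mass n y)%:E)%E.
Proof.
move=> r_ge0; have uv : x - r <= x + r by lra.
have /andP[_ h] := muP n uv.
apply: (@le_trans _ _ (mu `]x - r, x + r]%classic)).
  apply: le_measure; rewrite ?inE//.
    exact: measurable_realfun.measurable_ball.
  move=> z /=; rewrite in_itv/= /ball/= ltr_norml => /andP[z1 z2].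
  by apply/andP; split; lra.
apply: (le_trans h); rewrite lee_fin [leLHS]big_mkcond [leRHS]big_mkcond/=.
apply: ler_sum => y _; case: ifPn => [/andP[y1 y2]|_].
  by rewrite ifT// ler_norml; lra.
by case: ifP => // _; exact: ltW.
Qed.

Lemma mu_ball_gt0 x r : E x -> 0 < r -> (0 < mu (ball (x : R^o) r))%E.
Proof.
move=> Ex r_gt0; have [|n rn] := @net_radius_small (r / 3); first by rewrite divr_gt0.
have [y yN xy] := net_cover T n Ex.
apply: (@lt_le_trans _ _ (mass n y)%:E); first by rewrite lte_fin.
by apply: mu_ball_ge => //; lra.
Qed.

Lemma mu_support : closed (E : set R^o) -> msupport (mu : set R^o -> \bar R) = E.
Proof.
move=> cE; apply/seteqP; split => x.
  move=> xsupp; apply: contrapT => xE.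
  have : nbhs (x : R^o) (~` E).
    by apply: open_nbhs_nbhs; split => //; exact: closed_openC.
  move=> /nbhs_ballP[e /= e_gt0 eE].
  have [|n ne] := @net_radius_small (e / 4); first by rewrite divr_gt0.
  have := xsupp (ball (x : R^o) (e / 2)) (ball_open _ _) (ballxx _ _).
  have e2 : 0 < e / 2 by rewrite divr_gt0.
  move=> /(_ e2); apply/negP; rewrite -leNgt.
  apply: (le_trans (mu_ball_le n x _)); first by rewrite divr_ge0 ?ltW.
  rewrite big_seq_cond big_pred0// => y; apply/negbTE/negP => /andP[yN xy].
  apply: (eE y); last exact: (net_sub T yN).
  by rewrite /ball/=; lra.
move=> Ex U oU Ux; have /nbhs_ballP[e /= e_gt0 eU] := open_nbhs_nbhs (conj oU Ux).
apply: lt_le_trans (mu_ball_gt0 Ex e_gt0) _.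
apply: le_measure; rewrite ?inE//.
  exact: measurable_realfun.measurable_ball.
exact: measurable_realfun.open_measurable.
Qed.

Lemma mu_ball_ratio x t r M : E x -> 0 < r ->
  ((mu (ball (x : R^o) t) / mu (ball (x : R^o) r) <= M%:E)
   = (mu (ball (x : R^o) t) <= M%:E * mu (ball (x : R^o) r)))%E.
Proof.
move=> Ex r_gt0; have := mu_ball_gt0 Ex r_gt0.
have : mu (ball (x : R^o) r) \is a fin_num.
  by apply: fin_num_measure; exact: measurable_realfun.measurable_ball.
case: (mu _) => // p _; rewrite lte_fin => p_gt0.
by rewrite inver gt_eqF// lee_pdivrMr.
Qed.

(** An exponent admissible for [mu] is a decay exponent: the ball of radius [4 * rho k] around [y]
    holds the mass of the ancestor of [y], the ball of radius [rho n / 4] at most that of [y], and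
    the radii have quotient [16 * b ^+ l]. *)
Lemma assouad_dim_measure_ge (c : \bar R) : closed (E : set R^o) ->
  (forall a, homogeneous s a -> (c <= a%:E)%E) ->
  (c <= assouad_dim_measure (mu : set R^o -> \bar R))%E.
Proof.
move=> cE hc; apply: le_ereal_inf_tmp => _ [a [C1 [C2 [C1_gt0 C2_gt0 dim]]] <-].
apply: hc; rewrite mu_support// in dim; have b0 := net_base_gt0 T.
have [|K KC] := @net_radius_small (C1 / 4); first by rewrite divr_gt0.
exists K, (C2 * 16 `^ a); split=> [|k l y Kk yN].
  by rewrite mulr_gt0// powR_gt0.
set n := (k + l)%N in yN.
have rk := rho_gt0 k; have rn := rho_gt0 n; have rn1 := rho_gt0 n.+1.
have nk : rho n <= rho k by rewrite (net_radius_le T)// leq_addr.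
have kK : rho k <= rho K by exact: (net_radius_le T).
have nn := net_radius64 T n; have Ey := net_sub T yN.
have zN := ancestor_mem T yN; have yz := ancestor_dist T yN.
have rn4 : 0 < rho n / 4 by rewrite divr_gt0.
have := dim (rho n / 4) (4 * rho k) rn4.
move=> /(_ ltac:(lra) ltac:(lra)) dimy.
have : (mu (ball (y : R^o) (4 * rho k)) / mu (ball (y : R^o) (rho n / 4))
    <= (C2 * (4 * rho k / (rho n / 4)) `^ a)%:E)%E.
  by apply: le_trans dimy; apply: ereal_sup_ubound; exists y.
rewrite mu_ball_ratio// => mudim.
have /(le_trans (mu_ball_ge zN _)) : (mu (ball (y : R^o) (4 * rho k)) <=
    (C2 * (4 * rho k / (rho n / 4)) `^ a)%:E * (mass n y)%:E)%E.
  apply: (le_trans mudim); apply: lee_wpmul2l.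
    by rewrite lee_fin mulr_ge0 ?powR_ge0// ltW.
  (* Points of [N n.+1] this close to [y] are its children by [par_near], since
     [rho n / 4 + 2 * rho n.+1 < rho n / 2]. *)
  apply: (le_trans (mu_ball_le n.+1 y (ltW rn4))).
  rewrite lee_fin -(mass_par T s yN) [leLHS]big_mkcond [leRHS]big_mkcond.
  rewrite [leLHS]big_seq [leRHS]big_seq; apply: ler_sum => w wN.
  case: ifP => [yw|_]; last by case: ifP => // _; exact: ltW.
  by rewrite ifT// (par_near T wN yN) ?eqxx// distrC; lra.
have -> : 4 * rho k / (rho n / 4) = 16 * b ^+ l.
  rewrite /n exprD; have bk : b ^+ k != 0 by rewrite expf_neq0// gt_eqF.
  have bl : b ^+ l != 0 by rewrite expf_neq0// gt_eqF.
  have r00 : r0 != 0 by rewrite gt_eqF// (net_r0 T).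
  by field; rewrite bk bl r00.
rewrite -EFinM lee_fin => /(_ ltac:(lra)).
rewrite /n mass_branch mulrA -[leLHS]mul1r ler_pM2r//.
by rewrite powRM ?exprn_ge0 ?(ltW b0)// -powR_expn mulrA.
Qed.

(** For constant [s], [mass_near] bounds the level [k] masses in the large ball by that of one
    ancestor [z], and homogeneity carries it down to a point [y] of level [n] whose mass stays in
    the small ball. *)
Lemma assouad_dim_measure_le t a : closed (E : set R^o) -> (forall n, s n = t) ->
  0 <= a -> homogeneous s a ->
  (assouad_dim_measure (mu : set R^o -> \bar R) <= a%:E)%E.
Proof.
move=> cE st a_ge0 [K [C [C_gt0 hom]]].
have b0 := net_base_gt0 T; have lam0 := ratio_gt0 T t.
apply: ereal_inf_lbound; exists a => //.
exists (rho K), (7 * b `^ t * C * (4 * b ^+ 2) `^ a); split => //.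
  by rewrite !mulr_gt0// powR_gt0// mulr_gt0// exprn_gt0.
move=> r u r_gt0 ru uK; rewrite mu_support//.
have [k [l [Kk uk rkl bl]]] := scales r_gt0 ru uK.
suff doubling (x : R) : E x -> (mu (ball (x : R^o) u) <=
    (7 * b `^ t * C * (4 * b ^+ 2) `^ a * (u / r) `^ a)%:E
      * mu (ball (x : R^o) r))%E.
  by apply: ge_ereal_sup => _ [x Ex <-]; rewrite mu_ball_ratio//; exact: doubling.
move=> Ex; set n := (k + l)%N in rkl; have rn := rho_gt0 n; have rk := rho_gt0 k.
have nk : rho n <= rho k by rewrite (net_radius_le T)// leq_addr.
have [y yN xy] := net_cover T n Ex; pose z := anc k l y.
have zN : z \in N k := ancestor_mem T yN; have yz := ancestor_dist T yN.
(* The points [w] and [z] are within [(3 + 1 + 2) * rho k], in the reach of [mass_near]. *)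
have near_z w : w \in N k -> `|x - w| <= u + 2 * rho k ->
    mass k w <= b `^ t * mass k z.
  move=> wN xw; rewrite -ler_pdivrMl// -powRN.
  have sE : s = fun=> t by apply/funext.
  have := mass_near (t := t) _ wN zN; rewrite -sE; apply.
    by rewrite -(st 0%N).
  move: xw xy yz; rewrite -/z !ler_norml !ltr_norml.
  by lra.
pose S := [seq w <- N k | `|x - w| <= u + 2 * rho k].
have Ssize : (size S <= 7)%N.
  apply: (@size_separated _ (rho k) (x - 3 * rho k)) => //.
  - by rewrite filter_uniq// (net_uniq T).
  - move=> v w; rewrite !mem_filter => /andP[_ vN] /andP[_ wN].
    exact: (net_sep T).
  - by move=> w; rewrite mem_filter => /andP[+ _]; rewrite ler_norml; lra.
have u_ge0 : 0 <= u by lra.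
apply: (@le_trans _ _ ((7 * b `^ t * C * (4 * b ^+ 2) `^ a * (u / r) `^ a)%:E
    * (mass n y)%:E)%E); last first.
  apply: lee_wpmul2l.
    by rewrite lee_fin !mulr_ge0 ?powR_ge0// ltW.
  by apply: mu_ball_ge => //; lra.
apply: (le_trans (mu_ball_le k x u_ge0)); rewrite -EFinM lee_fin.
apply: (@le_trans _ _ (7 * (b `^ t * mass k z))).
  rewrite -big_filter -/S.
  apply: (@le_trans _ _ (\sum_(w <- S) b `^ t * mass k z)).
    rewrite big_seq [leRHS]big_seq; apply: ler_sum => w.
    by rewrite mem_filter => /andP[xw wN]; exact: near_z.
  rewrite big_const_seq count_predT iter_addr_0 -[leLHS]mulr_natl ler_pM2r.
    by rewrite ler_nat.
  by rewrite mulr_gt0.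
have := hom k l y Kk yN.
have := powR_expn_le a_ge0 bl.
rewrite powRM ?divr_ge0 ?mulr_ge0 ?exprn_ge0 ?(ltW b0) ?(ltW r_gt0)// => bla homy.
rewrite /n mass_branch -/z.
rewrite -!mulrA !ler_pM2l// !mulrA -[leLHS]mul1r ler_pM2r//.
apply: (le_trans homy); rewrite ler_pM2r ?(branch_gt0 T E_neq0 children_le)//.
by rewrite -!mulrA ler_pM2l.
Qed.

End Measure.
End TreeMeasure.

(** * Bounding the number of new children by the dimension of the set *)

Lemma covering_number_ge (R : realType) (r t : R) (F : set R) (S : seq R) :
  r < t -> uniq S -> separated t S -> {in S, forall x, F x} ->
  ((size S)%:R%:E <= covering_number r (F : set R^o))%E.
Proof.
move=> rt uS sS SF; apply: le_ereal_inf_tmp => _ [n [U [dU FU]] <-].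
rewrite lee_fin ler_nat.
(* A set of diameter at most [r < t] contains at most one point of [S], so choosing a covering set
   for each point is injective. *)
have /choice[f fP] (y : R) : exists k : nat, y \in S -> exists2 i : 'I_n, k = i & U i y.
  have [yS|] := boolP (y \in S); last by exists 0%N.
  by have [i _ Uy] := FU _ (SF _ yS); exists i => _; exists i.
rewrite -(size_map f) -(size_iota 0 n); apply: uniq_leq_size; last first.
  by move=> _ /mapP[y /fP[i -> _] ->]; rewrite mem_iota/=.
rewrite map_inj_in_uniq// => y z yS zS fyz; apply/eqP/negP => /negP yz.
have [i fi Uy] := fP _ yS; have [j fj Uz] := fP _ zS.
have ij : i = j by apply/ord_inj; rewrite -fi -fj.
have : ((mdist (z : R^o) y)%:E <= r%:E)%E.
  apply: le_trans (dU i); apply: ereal_sup_ubound; right.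
  by exists ((z : R^o), (y : R^o)) => //; split => //=; rewrite ij.
rewrite lee_fin; have -> : mdist (z : R^o) y = `|y - z| by [].
by apply/negP; rewrite -ltNge; apply: lt_le_trans rt _; exact: sS.
Qed.

(** [x] and its new children form a separated set at scale [r0 / b ^+ n.+1] inside the ball of
    radius [r0 / b ^+ n]. Covering at half the separation isolates them, whence the ratio
    [2 * b]. *)
Lemma new_children_le (R : realType) (E : set R) (b r0 a C1 C2 : R) N par n x :
  net_tree E b r0 N par -> r0 < C1 ->
  (forall r t : R, 0 < r -> r < t -> t < C1 ->
    (ereal_sup [set covering_number r (ball x t `&` (E : set R^o)) | x in (E : set R^o)]
      <= (C2 * (t / r) `^ a)%:E)%E) ->
  x \in N n -> (new_children N par n x).+1%:R <= C2 * (2 * b) `^ a.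
Proof.
move=> T r0C dimE xN; have b0 := net_base_gt0 T.
have rn := net_radius_gt0 T n; have rn1 := net_radius_gt0 T n.+1.
have nn := net_radius64 T n.
have n0 : r0 / b ^+ n <= r0.
  by have := net_radius_le T (leq0n n); rewrite expr0 divr1.
pose S := x :: [seq y <- N n.+1 | (y \notin N n) && (par n y == x)].
have SN : {subset S <= N n.+1}.
  move=> y; rewrite inE => /predU1P[->|]; first exact: (net_mono T).
  by rewrite mem_filter => /andP[].
have -> : (new_children N par n x).+1 = size S by rewrite /= size_filter.
rewrite -lee_fin.
have rt : r0 / b ^+ n.+1 / 2 < r0 / b ^+ n.+1 by lra.
apply: (@le_trans _ _ (covering_number (r0 / b ^+ n.+1 / 2)
    (ball (x : R^o) (r0 / b ^+ n) `&` (E : set R^o)))).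
  apply: (covering_number_ge rt).
  - by rewrite /= filter_uniq ?(net_uniq T)// mem_filter xN.
  - by move=> u v /SN uS /SN vS; exact: (net_sep T).
  - move=> y yS; split; last exact: (net_sub T (SN _ yS)).
    rewrite /ball/=; move: yS; rewrite inE => /predU1P[->|].
      by rewrite subrr normr0.
    rewrite mem_filter => /andP[/andP[_ /eqP <-]] yN.
    by rewrite distrC (par_dist T).
have -> : 2 * b = r0 / b ^+ n / (r0 / b ^+ n.+1 / 2).
  rewrite [in RHS](net_radiusS T n); move: (r0 / b ^+ n.+1) rn1 => p p_gt0.
  by field; rewrite gt_eqF.
apply: le_trans (dimE (r0 / b ^+ n.+1 / 2) (r0 / b ^+ n) _ _ _); [|lra..].
by apply: ereal_sup_ubound; exists x => //; exact: (net_sub T xN).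
Qed.

(** As [a < s], the power of [b] with exponent [s - a] outgrows the constant [X]. *)
Lemma net_base_exists (R : realType) (a s C : R) : a < s -> 0 < C ->
  exists2 b : R, 64 <= b & C * (2 * b) `^ a <= b `^ s / 2.
Proof.
move=> as_ C_gt0; have w0 : 0 < s - a by rewrite subr_gt0.
pose X := 2 * C * 2 `^ a; have X0 : 0 < X by rewrite !mulr_gt0// powR_gt0.
pose b := Num.max 64 (X `^ (s - a)^-1).
have b64 : 64 <= b by rewrite le_max lexx.
have b0 : 0 < b by lra.
exists b => //; rewrite powRM ?(ltW b0)//.
have : X <= b `^ (s - a).
  rewrite -[leLHS](powRr1 (ltW X0)) -(mulVf (lt0r_neq0 w0)) powRrM.
  by rewrite ge0_ler_powR ?nnegrE ?powR_ge0 ?(ltW w0) ?(ltW b0)// le_max lexx orbT.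
rewrite -(ler_pM2r (powR_gt0 a b0)) -powRD; last by rewrite (gt_eqF b0) implybT.
by rewrite subrK /X; lra.
Qed.

(** * Dependence of the decay exponents on [s] *)

Section Exponents.
Context (R : realType) (E : set R) (b r0 s0 : R) (N : nat -> seq R)
  (par : nat -> R -> R).
Hypothesis T : net_tree E b r0 N par.
Hypothesis E_neq0 : E !=set0.
Hypothesis children_le : forall n x, x \in N n ->
  (new_children N par n x).+1%:R <= b `^ s0 / 2.
Local Notation homogeneous := (homogeneous b N par).
Local Notation step := (step b N par).
Local Notation branch := (branch b N par).
Let b_gt0 := net_base_gt0 T.
Let b_ge1 := ltW (net_base_gt1 T).

Let powRDb x y : b `^ (x + y) = b `^ x * b `^ y.
Proof. by rewrite powRD// (gt_eqF b_gt0) implybT. Qed.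

Lemma homogeneousW s a a' : a <= a' -> (forall n, s0 <= s n) ->
  homogeneous s a -> homogeneous s a'.
Proof.
move=> aa' s_ge [K [C [C_gt0 hom]]]; exists K, C; split=> // k l y Kk yN.
apply: le_trans (hom k l y Kk yN) _.
rewrite ler_pM2r ?(branch_gt0 T E_neq0 children_le)// ler_pM2l//.
by rewrite lerXn2r ?nnegrE ?powR_ge0// ler_powR.
Qed.

Lemma branch_le s t D k l y : (forall n, s0 <= s n) -> (forall n, s0 <= t n) ->
  0 <= D -> (forall n z, (k <= n)%N -> step s n z <= D * step t n z) ->
  branch s k l y <= D ^+ l * branch t k l y.
Proof.
move=> s_ge t_ge D0 st; elim: l y => [|l IH] y /=; first by rewrite expr0 mul1r.
rewrite exprS mulrACA ler_pM//.
- exact: ltW (step_gt0 T E_neq0 children_le s_ge _ _).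
- exact: ltW (branch_gt0 T E_neq0 children_le s_ge _ _ _).
- by apply: st; rewrite leq_addr.
Qed.

(** This is the bound [A t <= t]: no step is smaller than the share of a new child. *)
Lemma homogeneous_const t : s0 <= t -> homogeneous (fun=> t) t.
Proof.
move=> st; exists 0%N, 1; split=> // k l y _ _; rewrite mul1r.
elim: l y => [|l IH] y /=; first by rewrite mulr1.
rewrite exprS mulrACA -[leLHS]mulr1 ler_pM// mulrC -ler_pdivrMr ?powR_gt0//.
by rewrite div1r -powRN (step_ge T E_neq0 children_le (s := fun=> t)).
Qed.

(** Each step changes at most by the factor [b] to the power [|t - t'|]. For old points this rests
    on the bound one half for the mass given away. *)
Lemma homogeneous_lipschitz t t' a : s0 <= t -> s0 <= t' ->
  homogeneous (fun=> t) a -> homogeneous (fun=> t') (a + `|t - t'|).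
Proof.
move=> st st' [K [C [C_gt0 hom]]]; exists K, C; split=> // k l y Kk yN.
apply: le_trans (hom k l y Kk yN) _.
rewrite powRDb exprMn -!mulrA ler_pM2l// ler_pM2l ?exprn_gt0 ?powR_gt0//.
apply: branch_le => //; first exact: powR_ge0.
move=> n z _; set d := `|t - t'|.
have d1 : 1 <= b `^ d by rewrite -(powRr0 b) ler_powR /d ?normr_ge0.
rewrite /step; case: ifPn => zN; last first.
  rewrite -powRDb ler_powR// /d; have := ler_norm (t' - t); rewrite distrC; lra.
set c := (new_children _ _ _ _)%:R.
have c_ge0 : 0 <= c by rewrite ler0n.
have half u : s0 <= u -> c * b `^ (- u) <= 1 / 2.
  move=> su; have := children_ratio T children_le su zN.
  rewrite -[X in X * _]natr1 mulrDl mul1r -/c.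
  by have := powR_gt0 (- u) b_gt0; lra.
have ct := half _ st; have ct' := half _ st'.
have [tt'|t't] := leP t t'.
  have : b `^ (- t') <= b `^ (- t) by rewrite ler_powR// lerN2.
  move=> /(ler_wpM2l c_ge0) h; apply: (@le_trans _ _ (1 - c * b `^ (- t'))).
    by lra.
  by rewrite ler_peMl//; lra.
have dE : d = t - t' by rewrite /d ger0_norm// subr_ge0 ltW.
have bt' : b `^ (- t') = b `^ d * b `^ (- t) by rewrite -powRDb dE; congr powR; ring.
have -> : b `^ d * (1 - c * b `^ (- t')) = b `^ d - b `^ d * (c * b `^ (- t')) by ring.
rewrite bt'; rewrite bt' in ct'.
set x := c * b `^ (- t) in ct *; move: (b `^ d) d1 ct' => B B1.
rewrite mulrCA -/x => Bx.
have x0 : 0 <= x by rewrite mulr_ge0// powR_ge0.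
(* The right side minus the left is [(B - 1) * (1 - x * (B + 1))], and
   [x * (B + 1) <= 2 * (B * x) <= 1]. *)
nra.
Qed.

(** Branch products for [s] are raised to the power [t / c]. A new step then is at most that for
    [t], since [c <= s n]; an old step stays at most 1, which exceeds the old step for [t] at most
    by the factor [b] to the power [e]. *)
Lemma homogeneous_compare s a t c e K' : (forall n, s0 <= s n) ->
  s0 <= t -> 0 < t -> 0 < c -> (forall n, (K' <= n)%N -> c <= s n) ->
  b `^ (- e) <= 1 - b `^ (s0 - t) ->
  homogeneous s a -> homogeneous (fun=> t) (a * (t / c) + e).
Proof.
move=> s_ge st t_gt0 c_gt0 cs be [K [C [C_gt0 hom]]].
have th_ge0 : 0 <= t / c by rewrite divr_ge0 ?ltW.
exists (maxn K K'), (C `^ (t / c)); split=> [|k l y]; first exact: powR_gt0.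
rewrite geq_max => /andP[Kk K'k] yN.
have Q_gt0 z m : 0 < branch s k m z by exact: (branch_gt0 T E_neq0 children_le).
have e_le1 : b `^ (- e) <= 1 by have := powR_ge0 b (s0 - t); lra.
have le m z : branch s k m z `^ (t / c) <= (b `^ e) ^+ m * branch (fun=> t) k m z.
  elim: m z => [|m IH] z /=; first by rewrite powR1 mulr1.
  have sz0 := step_gt0 T E_neq0 children_le s_ge (k + m) z.
  rewrite exprS mulrACA powRM ?(ltW (Q_gt0 _ _)) ?(ltW sz0)//.
  rewrite ler_pM ?powR_ge0// -ler_pdivrMl ?powR_gt0// -powRN.
  rewrite /step; case: ifPn => zN; last first.
    rewrite -powRrM; apply: (@le_trans _ _ (b `^ (- s (k + m)%N * (t / c)))).
      by rewrite ler_piMl// powR_ge0.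
    rewrite ler_powR// mulNr lerN2 mulrA ler_pdivlMr// mulrC ler_pM2r//.
    by apply: cs; rewrite (leq_trans K'k)// leq_addr.
  have sz1 : step s (k + m) z `^ (t / c) <= 1.
    rewrite -(powRr0 (step s (k + m) z)) ger_powR// sz0/=.
    exact: (step_le1 T E_neq0 children_le s_ge).
  rewrite /step zN in sz1.
  apply: (@le_trans _ _ (b `^ (- e))); first by rewrite ler_piMr// powR_ge0.
  apply: (le_trans be); rewrite lerB// powRDb ler_pM2r ?powR_gt0//.
  have := children_le zN; rewrite -[in X in X -> _]natr1.
  by have := powR_ge0 b s0; lra.
have hom1 := hom k l y Kk yN.
have : 1 `^ (t / c) <= (C * (b `^ a) ^+ l * branch s k l y) `^ (t / c).
  by rewrite ge0_ler_powR ?nnegrE// (le_trans ler01).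
rewrite powR1 => /le_trans; apply.
rewrite !powRM ?mulr_ge0 ?exprn_ge0 ?powR_ge0 ?(ltW C_gt0) ?(ltW (Q_gt0 _ _))//.
rewrite powRDb exprMn -!mulrA ler_pM2l ?powR_gt0//.
have -> : ((b `^ a) ^+ l) `^ (t / c) = (b `^ (a * (t / c))) ^+ l.
  by rewrite -!powR_mulrn ?powR_ge0// powRAC [in RHS]powRrM.
by rewrite ler_pM2l ?exprn_gt0 ?powR_gt0.
Qed.

(** For a suitably large [t], depending only on the tree and [d], the comparison costs [d / 2], so
    [assouad_dim_set_le] bounds [d] by a multiple [t / c] of the exponent plus [d / 2]. This gives
    [tau = d / (2 * t)]. *)
Lemma homogeneous_ge (d : R) : 0 < s0 -> 0 < d ->
  (d%:E <= assouad_dim_set (E : set R^o))%E ->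
  exists2 tau, 0 < tau & forall s c K a, (forall n, s0 <= s n) -> 0 < c ->
    (forall n, (K <= n)%N -> c <= s n) -> homogeneous s a -> c * tau <= a.
Proof.
move=> s0_gt0 d_gt0 dE.
have d2 : 0 < d / 2 by rewrite divr_gt0.
pose e := 1 - b `^ (- (d / 2)).
have e_gt0 : 0 < e.
  rewrite subr_gt0 powRN invf_lt1 ?powR_gt0//.
  have : 1 `^ (d / 2) < b `^ (d / 2).
    by rewrite gt0_ltr_powR ?nnegrE ?(ltW b_gt0) ?(net_base_gt1 T).
  by rewrite powR1.
(* This only serves to make the inverse of [b ^+ n] smaller than [e]; then [t = s0 + n] meets the
   condition of [homogeneous_compare]. *)
have [|n ne] := net_radius_small T (e := r0 * e).
  by rewrite mulr_gt0// (net_r0 T).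
rewrite ltr_pM2l ?(net_r0 T)// in ne.
pose t := s0 + n%:R; have t_gt0 : 0 < t by rewrite ltr_wpDr.
have st : s0 <= t by rewrite lerDl.
have be : b `^ (- (d / 2)) <= 1 - b `^ (s0 - t).
  rewrite (_ : s0 - t = - n%:R); last by rewrite /t; ring.
  by rewrite [b `^ (- n%:R)]powRN powR_mulrn ?(ltW b_gt0)//; move: ne; rewrite /e; lra.
exists (d / 2 / t); first by rewrite divr_gt0.
move=> s c K a s_ge c_gt0 cs hom.
(* A priori [a] may be negative, while [assouad_dim_set_le] asks for a nonnegative exponent. *)
have a'_ge0 : 0 <= Num.max a 0 by rewrite le_max lexx orbT.
have a_le : a <= Num.max a 0 by rewrite le_max lexx.
have homa := homogeneous_compare s_ge st t_gt0 c_gt0 cs be (homogeneousW a_le s_ge hom).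
have tc : 0 < t / c by rewrite divr_gt0.
have homa_ge0 : 0 <= Num.max a 0 * (t / c) + d / 2.
  by apply: addr_ge0 (ltW d2); exact: mulr_ge0 (ltW tc).
have := assouad_dim_set_le T E_neq0 children_le (fun=> st) homa_ge0 homa.
move=> /(le_trans dE); rewrite lee_fin => dle.
have : c * (d / 2 / t) <= Num.max a 0.
  have : d / 2 / (t / c) <= Num.max a 0 by rewrite ler_pdivrMr//; lra.
  by rewrite invfM invrK [t^-1 * _]mulrC mulrCA.
by rewrite le_max => /orP[//|]; rewrite leNgt mulr_gt0// divr_gt0.
Qed.

(** The intermediate value theorem for [A], which is at most [s0] at [s0] and at least [s0] at [t1].
    The value attained is the threshold [s0] itself, later [D]. The infimum need not be attained,
    hence the form with [e]. *)
Lemma homogeneous_exponent (tau : R) : 0 < s0 -> 0 < tau ->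
  (forall t a, s0 <= t -> homogeneous (fun=> t) a -> t * tau <= a) ->
  exists t, [/\ s0 <= t, forall a, homogeneous (fun=> t) a -> s0 <= a &
    forall e, 0 < e -> exists2 a, homogeneous (fun=> t) a & a < s0 + e].
Proof.
move=> s0_gt0 tau_gt0 tauP.
pose A t := inf [set a | homogeneous (fun=> t) a].
have A_inf t : s0 <= t -> has_inf [set a | homogeneous (fun=> t) a].
  move=> st; split; first by exists t; exact: homogeneous_const.
  by exists (t * tau) => a; exact: tauP.
have A_le t a : s0 <= t -> homogeneous (fun=> t) a -> A t <= a.
  by move=> st ha; apply: ge_inf => //; case: (A_inf t st).
have A_lip t t' : s0 <= t -> s0 <= t' -> A t' <= A t + `|t - t'|.
  move=> st st'; rewrite -lerBlDr; apply: lb_le_inf; first by case: (A_inf t st).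
  by move=> a ha; rewrite lerBlDr; apply: A_le => //; exact: homogeneous_lipschitz.
(* Freezing [A] to the left of [s0] gives a function that is Lipschitz on the whole line. *)
pose f t := A (Num.max s0 t).
have f_lip t t' : `|f t - f t'| <= `|t - t'|.
  have st u : s0 <= Num.max s0 u by rewrite le_max lexx.
  have max_lip : `|Num.max s0 t - Num.max s0 t'| <= `|t - t'|.
    by rewrite /Num.max; case: (ltP s0 t); case: (ltP s0 t'); rewrite !ler_norml;
      have := ler_norm (t - t'); have := ler_norm (t' - t); rewrite distrC; lra.
  have := A_lip _ _ (st t) (st t'); have := A_lip _ _ (st t') (st t).
  rewrite -/(f t) -/(f t') [`|_ - Num.max s0 t|]distrC => h1 h2.
  by apply: le_trans max_lip; rewrite ler_norml; lra.
have f_cont : continuous (f : R -> R).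
  move=> x; apply/cvgrPdist_le => eps eps_gt0; near=> y.
  apply: le_trans (f_lip _ _) _; near: y; exact: cvgr_dist_le.
pose t1 := Num.max s0 (s0 / tau).
have st1 : s0 <= t1 by rewrite le_max lexx.
have fs0 : f s0 <= s0.
  by rewrite /f maxxx; apply: A_le => //; exact: homogeneous_const.
have ft1 : s0 <= f t1.
  have -> : f t1 = A t1 by rewrite /f; congr A; apply/max_idPr.
  apply: lb_le_inf; first by case: (A_inf _ st1).
  move=> a /(tauP _ _ st1); apply: le_trans.
  by rewrite -ler_pdivrMr// le_max lexx orbT.
have [||t] := @IVT _ f s0 t1 s0 st1.
- exact: continuous_subspaceT.
- by rewrite ge_min fs0 le_max ft1 orbT.
rewrite in_itv/= => /andP[st _]; have -> : f t = A t by rewrite /f; congr A; apply/max_idPr.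
move=> At; exists t; split=> // [a|e e_gt0].
  by rewrite -At; exact: A_le.
by have [a ha] := inf_adherent e_gt0 (A_inf t st); rewrite -/(A t) At; exists a.
Unshelve. all: by end_near. Qed.

End Exponents.

(** An admissible exponent [a < s0] bounds the children by a multiple of the [a]-th power of
    [2 * b], which a large [b] beats. The radius [C1 / 2] keeps all scales in the range of the
    dimension estimate. *)
Lemma net_tree_sparse (R : realType) (E : set R) (s0 : R) :
  E `<=` `[0, 1] -> (assouad_dim_set (E : set R^o) < s0%:E)%E ->
  exists b r0 N par, net_tree E b r0 N par /\
    forall n x, x \in N n -> (new_children N par n x).+1%:R <= b `^ s0 / 2.
Proof.
move=> E01 /ereal_inf_lt[_ [a [C1 [C2 [C1_gt0 C2_gt0 dimE]]] <-]].
rewrite lte_fin => a_s0; have [b b64 bC] := net_base_exists a_s0 C2_gt0.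
have r0_gt0 : 0 < C1 / 2 by rewrite divr_gt0.
have [N [par T]] := net_tree_exists E01 b64 r0_gt0.
exists b, (C1 / 2), N, par; split => // n x xN; apply: le_trans bC.
by apply: (new_children_le (C1 := C1) T _ _ xN) => //; lra.
Qed.

(* R^o is the real line as a metric space; measurableTypeR R is the real line
   with its Borel sigma-algebra. *)
Theorem theorem3p2 (R : realType) (E : set R^o) (E01 : E `<=` `[0, 1])
  (cE : compact E) (E_gt0 : (0 < assouad_dim_set E)%E)
  (D : \bar R) (D_gt : (assouad_dim_set E < D)%E) :
  exists mu : probability (measurableTypeR R) R,
    msupport (mu : set R^o -> \bar R) = E /\
    assouad_dim_measure (mu : set R^o -> \bar R) = D.
Proof.
have E_closed : closed E by apply: compact_closed => //; exact: norm_hausdorff.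
(* For the empty set the exponent 0 is admissible, as the supremum over no points is [-oo]. *)
have E_neq0 : E !=set0.
  apply/set0P/negP => /eqP E0; move: E_gt0; apply/negP; rewrite -leNgt.
  apply: ereal_inf_lbound; exists 0 => //; exists 1, 1; split=> // r t _ _ _.
  by rewrite E0 image_set0 ereal_sup0 leNye.
have [d dimE d_gt0] : exists2 d : R, assouad_dim_set E = d%:E & 0 < d.
  case: (assouad_dim_set E) E_gt0 D_gt => // d; last by case: D.
  by rewrite lte_fin => d_gt0 _; exists d.
case: D D_gt => [D| |]; rewrite dimE// => D_gt.
(* For finite [D] the threshold of the tree is [D] itself, so [homogeneous_exponent] yields a
   constant [t >= D] with decay rate [D]. *)
- have D_gt' : (assouad_dim_set E < D%:E)%E by rewrite dimE.
  have D_gt0 : 0 < D by rewrite (lt_trans d_gt0).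
  have [b [r0 [N [par [T children_le]]]]] := net_tree_sparse E01 D_gt'.
  have [|tau tau_gt0 tauP] := homogeneous_ge T E_neq0 children_le D_gt0 d_gt0.
    by rewrite dimE.
  have [|t [Dt t_ge t_lt]] :=
      homogeneous_exponent T E_neq0 children_le D_gt0 tau_gt0.
    move=> t a Dt; apply: (tauP _ _ 0%N) => //.
    exact: lt_le_trans Dt.
  have t_ge' (n : nat) : D <= (fun=> t) n by [].
  have [mu muP] := tree_measure T E_neq0 children_le t_ge'.
  exists mu; split; first exact: (mu_support T E_neq0 children_le t_ge' muP).
  apply/eqP; rewrite eq_le; apply/andP; split; last first.
    exact: (assouad_dim_measure_ge T E_neq0 children_le t_ge' muP).
  apply/lee_addgt0Pr => e e_gt0; have [a ta ae] := t_lt e e_gt0.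
  apply: (@le_trans _ _ a%:E); last by rewrite -EFinD lee_fin ltW.
  apply: (assouad_dim_measure_le T E_neq0 children_le t_ge' muP) => //.
  by rewrite (le_trans (ltW D_gt0))// t_ge.
(* For [D = +oo] any real threshold above the dimension would do. *)
- have D_gt' : (assouad_dim_set E < (d + 1)%:E)%E by rewrite dimE lte_fin ltrDl.
  have d1_gt0 : 0 < d + 1 by rewrite addr_gt0.
  have [b [r0 [N [par [T children_le]]]]] := net_tree_sparse E01 D_gt'.
  have [|tau tau_gt0 tauP] := homogeneous_ge T E_neq0 children_le d1_gt0 d_gt0.
    by rewrite dimE.
  pose s (n : nat) : R := d + 1 + n%:R.
  have s_ge n : d + 1 <= s n by rewrite lerDl.
  have [mu muP] := tree_measure T E_neq0 children_le s_ge.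
  exists mu; split; first exact: (mu_support T E_neq0 children_le s_ge muP).
  apply/eqP; rewrite eq_le leey/=.
  apply: (assouad_dim_measure_ge T E_neq0 children_le s_ge muP) => // a sa.
  (* From level [K] on all exponents are at least [K], so homogeneity would give [K * tau <= a],
     against the choice of [K]. *)
  exfalso; pose K := (Num.truncn (a / tau)).+1.
  have aK : a / tau < K%:R.
    have [a_lt0|a_ge0] := ltP a 0.
      by rewrite (@lt_trans _ _ 0)// pmulr_llt0// invr_gt0.
    by have /truncn_itv/andP[] : 0 <= a / tau by rewrite divr_ge0// ltW.
  have K_gt0 : 0 < K%:R :> R by rewrite ltr0n.
  have Ks n : (K <= n)%N -> K%:R <= s n.
    by rewrite -(ler_nat R) => /le_trans; apply; rewrite lerDr ltW.
  have := tauP s K%:R K a s_ge K_gt0 Ks sa.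
  by apply/negP; rewrite -ltNge -ltr_pdivrMr.
Qed.
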